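(* Let $H$ be a $3$-chromatically connected graph and let $r \geq 2$ be an integer. For every integer $s \geq 2$, there exists a graph $G$ such that $G \stackrel{r}{\to} H$ but $G[s] \stackrel{r}{\not\to} H[2]$. That is, every $r$-colouring of the edges of $G$ contains a monochromatic copy of $H$, but there is an $r$-colouring of the edges of $G[s]$ which contains no monochromatic copy of $H[2]$.
   Context: A graph $H$ is $3$-chromatically connected if $|V(H)|\geq 3$ and for all $V \subseteq V(H)$ such that the subgraph of $H$ induced on $V$ is bipartite, the graph $H-V$ (obtained by deleting the vertices in $V$) is connected. For graphs $G,H$ and $r\in\mathbb{N}$, write $G \stackrel{r}{\to} H$ if every $r$-colouring of the edges of $G$ contains a monochromatic copy of $H$, and $G \stackrel{r}{\not\to} H$ if this is not the case. For a graph $H$ and $t\in\mathbb{N}$, the $t$-blowup $H[t]$ is the graph obtained from $H$ by replacing each vertex of $H$ by an independent set of size $t$ and replacing every edge of $H$ by a complete bipartite graph $K_{t,t}$ between the corresponding parts. *)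

(* Defs.v *)
From mathcomp Require Import all_boot.
Set Implicit Arguments.
Unset Strict Implicit.
Unset Printing Implicit Defensive.

(* Finite simple graphs. *)
Record sgraph := SGraph {
  vertex :> finType;
  adj : rel vertex;
  adj_sym : symmetric adj;
  adj_irr : irreflexive adj }.

Section Induced.
Variables (G : sgraph) (A : {set G}).

Definition induced_adj : rel {x : G | x \in A} :=
  fun x y => adj (val x) (val y).

Lemma induced_adj_sym : symmetric induced_adj.
Proof. by move=> x y; apply: adj_sym. Qed.

Lemma induced_adj_irr : irreflexive induced_adj.
Proof. by move=> x; apply: adj_irr. Qed.

Definition induced : sgraph := SGraph induced_adj_sym induced_adj_irr.
End Induced.

Definition delete_vertices (G : sgraph) (A : {set G}) : sgraph := induced (~: A).

Section Blowup.
Variables (G : sgraph) (t : nat).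

Definition blowup_adj : rel (G * 'I_t)%type := fun x y => adj x.1 y.1.

Lemma blowup_adj_sym : symmetric blowup_adj.
Proof. by move=> x y; apply: adj_sym. Qed.

Lemma blowup_adj_irr : irreflexive blowup_adj.
Proof. by move=> x; apply: adj_irr. Qed.

Definition blowup : sgraph := SGraph blowup_adj_sym blowup_adj_irr.
End Blowup.

Definition bipartite (G : sgraph) : Prop :=
  exists side : G -> bool, forall x y : G, adj x y -> side x != side y.

(* The graph without vertices counts as connected. In the next definition this
   convention is immaterial: it only matters when H is bipartite, and a
   bipartite H with at least 3 vertices has two non-adjacent vertices u, v;
   deleting all the others leaves a disconnected graph. *)
Definition connected (G : sgraph) : Prop :=
  forall x y : G, connect (@adj G) x y.

Definition chromatically_connected3 (H : sgraph) : Prop :=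
  3 <= #|H| /\
  forall V : {set H}, bipartite (induced V) -> connected (delete_vertices V).

(* Edges are the two-element sets [set x; y] with adj x y. A colouring of the
   edges is given as a function on all vertex sets, of which only the values on
   edges are ever used; for r > 0 every colouring of the edges extends so. *)
Definition edge_colouring (G : sgraph) (r : nat) := {set G} -> 'I_r.

(* Copies are not-necessarily-induced subgraphs. *)
Definition has_mono_copy (G H : sgraph) (r : nat) (c : edge_colouring G r) :
    Prop :=
  exists (k : 'I_r) (f : H -> G),
    injective f /\
    forall x y : H, adj x y -> adj (f x) (f y) /\ c [set f x; f y] = k.

Definition arrows (G : sgraph) (r : nat) (H : sgraph) : Prop :=
  forall c : edge_colouring G r, has_mono_copy H c.

(* Main.v *)
Require Import Defs.
From mathcomp Require Import all_boot.
Set Implicit Arguments.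
Unset Strict Implicit.
Unset Printing Implicit Defensive.

(** Let q be the chromatic number of H; it is at least 3, because a bipartite
    graph is never 3-chromatically connected.

    The colouring of the blow-up. Suppose that the vertices of G are sorted
    into types, one of which, None, is distinguished; that some of the other
    types carry a subset A of the s copy indices; and that the edges avoiding
    None carry a label in 'I_r. Colour G[s] as follows: an edge avoiding None
    gets its label, and the edge from the i-th copy of a vertex of type None to
    a vertex carrying A gets colour 0 if i lies in A and colour 1 otherwise
    [tint]. Place H so that its first class has type None, its second class
    carries A, the remaining classes carry A', and all edges between these are
    labelled k. In colour k this copy of H is monochromatic only over those
    indices i at which both A and A' give colour k. If there is at most one
    such index, [few A A' k], then over the copy of H there is no
    monochromatic H[2]: the vertices of the first class over the other indices
    can be moved to another class, so H[2] would be q-coloured with a first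
    class consisting of vertices over a single index, hence with no more
    vertices than the first class of H, whereas each of the two disjoint copies of H inside H[2]
    already needs as many, if that first class was chosen as small as possible
    among all q-colourings of H [arrows_blowup_separation].

    A colouring of G itself cannot use the index. As soon as it depends on types
    and labels only, it assigns to each set A one colour mu A, and any such mu
    is caught: there are A, A' with mu A = mu A' = k and [few A A' k]
    [few_clash]. Finitely many labelled copies of H also force a colouring
    without monochromatic H to permute the labels. So there is a finite list of
    patterns of complete q-partite shape, each harmless in the blow-up, one of
    which is monochromatic in every colouring that depends on types and labels
    only [mono_pattern].

    From patterns to a graph. The partite construction of Nesetril and Rodl,
    started from the disjoint union of a copy of H for each pattern, yields a
    graph each of whose colourings depends on types and labels only on some
    copy of that union [partite_construction]. It glues copies along bipartite
    graphs, and a homomorphic image of a 3-chromatically connected graph J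
    cannot be spread over several copies glued in this way, because the
    preimage of a bipartite graph does not separate J [amalgam_hom]. Hence all
    homomorphisms from J to the final graph stay within a single pattern.

    If H is not the triangle, then H[2] is again 3-chromatically connected
    [chromatically_connected3_blowup2], and J = H[2] finishes the proof. The
    octahedron K_3[2] is not: a monochromatic octahedron may use one edge of
    labelled type together with distinguished vertices of different copies. For
    the triangle all vertices of type None are therefore merged into a single
    vertex; then J = K_3 shows that every monochromatic triangle uses the
    merged vertex, over an index determined by the opposite edge
    [arrows_blowup_separation_triangle]. *)

(** * The Hales-Jewett theorem *)

Section HalesJewett.
Variable A : finType.
Implicit Types (L : seq (option A)) (a b : A) (S : seq A).

(** A combinatorial line is a word over [option A]; its active coordinates are
    those holding [None]. *)
Definition instantiate L a : seq A := map (odflt a) L.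

Lemma instantiate_cat L L' a :
  instantiate (L ++ L') a = instantiate L a ++ instantiate L' a.
Proof. exact: map_cat. Qed.

Lemma instantiate_const w a : instantiate (map Some w) a = w.
Proof. by rewrite /instantiate -map_comp map_id. Qed.

Definition mono_line (C : Type) (c : seq A -> C) n S L :=
  [/\ size L = n, None \in L &
      {in S &, forall a b, c (instantiate L a) = c (instantiate L b)}].

(** Colour focusing, by induction on the letters in S. For the step, enough
    colours are spent on a prefix to make its line constant as seen by every
    suffix; this either extends a monochromatic line or adds one more line to a
    family of lines sharing their value at the new letter x but having pairwise
    different colours on S. Such a family has fewer members than colours. *)
Lemma Hales_Jewett S (C : finType) :
  exists n, forall c : seq A -> C, exists L, mono_line c n S L.
Proof.
elim: S C => [|x S IH] C.
  by exists 1 => c; exists [:: None]; split.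
case: S IH => [|a0 S0] IH.
  by exists 1 => c; exists [:: None]; split=> // a b; rewrite !inE => /eqP-> /eqP->.
set S := a0 :: S0 in IH *.
have a0S : a0 \in S by rewrite mem_head.
have focus j : exists m, forall c : seq A -> C,
    (exists L, mono_line c m (x :: S) L) \/
    exists (Ls : seq (seq (option A))) (f : seq A),
      [/\ size Ls = j, size f = m,
          {in Ls, forall L, mono_line c m S L /\ instantiate L x = f} &
          uniq (c f :: [seq c (instantiate L a0) | L <- Ls])].
  elim: j => [|j [m IHj]]; first by exists 0 => c; right; exists [::], [::].
  have [n HJ] := IH {ffun m.-tuple A -> C}.
  exists (n + m) => c.
  have [L [szL NL monoL]] := HJ (fun u => [ffun v : m.-tuple A => c (u ++ v)]).
  have cL a v : a \in S -> size v = m ->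
      c (instantiate L a ++ v) = c (instantiate L a0 ++ v).
    move=> aS /eqP szv; have := monoL _ _ aS a0S.
    by move/ffunP/(_ (Tuple szv)); rewrite !ffunE.
  have [[L' [szL' NL' mL']]|[Ls [f [szLs szf foc unq]]]] :=
    IHj (fun v => c (instantiate L a0 ++ v)).
    left; exists (map Some (instantiate L a0) ++ L'); split.
    - by rewrite size_cat !size_map szL szL'.
    - by rewrite mem_cat NL' orbT.
    - by move=> a b aS bS; rewrite !instantiate_cat !instantiate_const; exact: mL'.
  pose Ls' := (L ++ map Some f) :: [seq L ++ L' | L' <- Ls].
  have foc' : {in Ls', forall M, mono_line c (n + m) S M
                              /\ instantiate M x = instantiate L x ++ f}.
    move=> M; rewrite inE => /orP[/eqP->|/mapP[L' /foc[[szL' NL' mL'] fx] ->]].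
      rewrite instantiate_cat instantiate_const; split=> //; split.
      - by rewrite size_cat size_map szL szf.
      - by rewrite mem_cat NL.
      - by move=> a b aS bS; rewrite !instantiate_cat !instantiate_const !cL.
    rewrite instantiate_cat fx; split=> //; split.
    - by rewrite size_cat szL szL'.
    - by rewrite mem_cat NL.
    - move=> a b aS bS; rewrite !instantiate_cat !cL ?size_map //.
      exact: mL'.
  have colE : [seq c (instantiate M a0) | M <- Ls'] =
      c (instantiate L a0 ++ f)
        :: [seq c (instantiate L a0 ++ instantiate L' a0) | L' <- Ls].
    rewrite /Ls' /= instantiate_cat instantiate_const -map_comp; congr (_ :: _).
    by apply: eq_map => L' /=; rewrite instantiate_cat.
  have [/mapP[M MLs cM]|cN] := boolP
      (c (instantiate L x ++ f) \in [seq c (instantiate M a0) | M <- Ls']).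
    have [[szM NM mM] Mx] := foc' _ MLs.
    left; exists M; split=> // a b.
    suff cE a' : a' \in x :: S -> c (instantiate M a') = c (instantiate M a0).
      by move=> /cE-> /cE->.
    rewrite inE => /orP[/eqP->|a'S]; first by rewrite Mx.
    exact: mM.
  right; exists Ls', (instantiate L x ++ f); split=> //.
  - by rewrite /= size_map szLs.
  - by rewrite size_cat size_map szL szf.
  - by rewrite cons_uniq cN colE.
have [m Hm] := focus #|C|; exists m => c.
have [//|[Ls [f [szLs _ _ /card_uniqP unq]]]] := Hm c.
by have := max_card (mem (c f :: [seq c (instantiate L a0) | L <- Ls]));
  rewrite unq /= size_map szLs ltnn.
Qed.

End HalesJewett.

(** * Ramsey's theorem for pairs *)

(** One target size per colour makes the induction on the sum of the targets
    direct: the head of the sequence lowers the target of one colour. *)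
Lemma ramsey_seq (C : finType) (nu : C -> nat) :
  exists N, forall (T : eqType) (c : T -> T -> C) (s : seq T), N <= size s ->
    exists k s', [/\ subseq s' s, size s' = nu k &
                    pairwise (fun x y => c x y == k) s'].
Proof.
have [n] := ubnP (\sum_k nu k); elim: n nu => // n IH nu le_nu.
have [/existsP[k /eqP nuk]|/existsPn nu_gt0] := boolP [exists k, nu k == 0].
  by exists 0 => T c s _; exists k, [::]; split; rewrite ?sub0seq.
pose nu' k l := nu l - (l == k).
have lt_nu' k : \sum_l nu' k l < n.
  apply: leq_trans (_ : \sum_l nu l <= n) => //.
  rewrite (bigD1 k) //= [leqRHS](bigD1 k) //= /nu' eqxx subn1.
  rewrite -addSn prednK ?lt0n ?nu_gt0 // leq_add2l.
  by apply: leq_sum => l _; rewrite leq_subr.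
have [Nf HN] := fin_all_exists (fun k => IH _ (lt_nu' k)).
exists (\sum_k Nf k).+1 => T c [|x s] //= le_s.
have szE : size s = \sum_k count (fun y => c x y == k) s.
  elim: s {le_s} => [|y s IHs] /=; first by rewrite big1.
  rewrite big_split /= -IHs (bigD1 (c x y)) //= eqxx big1 ?addn0 ?add1n //.
  by move=> k; rewrite eq_sym => /negPf->.
have [/existsP[k le_k]|/existsPn lt_k] :=
    boolP [exists k, Nf k <= count (fun y => c x y == k) s].
  rewrite -size_filter in le_k.
  have [l [s' [sub_s' sz_s' mono_s']]] := HN k T c _ le_k.
  have sub_s : subseq s' s := subseq_trans sub_s' (filter_subseq _ _).
  have [lk|lk] := eqVneq l k; last first.
    exists l, s'; split=> //; first exact: subseq_trans sub_s (subseq_cons _ _).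
    by rewrite sz_s' /nu' (negPf lk) subn0.
  subst l; exists k, (x :: s'); split=> /=.
  - by rewrite eqxx.
  - by rewrite sz_s' /nu' eqxx subn1 prednK // lt0n nu_gt0.
  - rewrite mono_s' andbT; apply/allP=> y /(mem_subseq sub_s').
    by rewrite mem_filter => /andP[].
have: \sum_k (count (fun y => c x y == k) s).+1 <= \sum_k Nf k.
  by apply: leq_sum => k _; rewrite ltnNge lt_k.
under eq_bigr do rewrite -add1n.
rewrite big_split /= -szE sum1_card => le_N.
have C0 : 0 < #|C| by apply/card_gt0P; exists (c x x).
have: #|C| + size s <= size s by apply: leq_trans le_N _; rewrite -ltnS.
by rewrite -{2}[size s]add0n leq_add2r leqNgt C0.
Qed.

Lemma ramsey (C : finType) m :
  exists N, forall c : 'I_N -> 'I_N -> C, exists (k : C) (th : 'I_m -> 'I_N),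
    forall i j : 'I_m, i < j -> th i < th j /\ c (th i) (th j) = k.
Proof.
have [N HN] := ramsey_seq (fun _ : C => m.+1); exists N.+1 => c.
have [|k [s [sub_s sz_s mono_s]]] := HN _ c (enum 'I_N.+1).
  by rewrite size_enum_ord.
exists k, (fun i => nth ord0 s i) => i j lt_ij.
have lt_j : j < size s by rewrite sz_s ltnS ltnW.
have srt : pairwise (fun x y : 'I_N.+1 => x < y) s.
  apply: subseq_pairwise sub_s _.
  rewrite -(pairwise_map (@nat_of_ord _) ltn) val_enum_ord.
  by rewrite -sorted_pairwise ?iota_ltn_sorted //; exact: ltn_trans.
have lt_i : i < size s := ltn_trans lt_ij lt_j.
split; first by move/(pairwiseP ord0): srt; apply.
by apply/eqP; move/(pairwiseP ord0): mono_s; apply.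
Qed.

(** * Chromatic connectivity *)

Definition graph_hom (J G : sgraph) (f : J -> G) :=
  forall x y, adj x y -> adj (f x) (f y).

Lemma connected_delete_ind (H : sgraph) (V : {set H}) (P : H -> Prop) :
  connected (delete_vertices V) ->
  (forall x y, x \notin V -> y \notin V -> adj x y -> P x -> P y) ->
  forall x y, x \notin V -> y \notin V -> P x -> P y.
Proof.
move=> conV step x y xV yV Px.
have xC : x \in ~: V by rewrite inE.
have yC : y \in ~: V by rewrite inE.
have /connectP[p] := conV (exist _ x xC) (exist _ y yC).
elim: p x xV xC Px => [|[z zC] p IH] x xV xC Px /=; first by move=> _ [->].
case/andP=> xz pz ey; have zV : z \notin V by rewrite -in_setC.
have {}xz : adj x z := xz.
exact: IH zV zC (step _ _ xV zV xz Px) pz ey.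
Qed.

Lemma bipartite_induced (H : sgraph) (V : {set H}) (side : H -> bool) :
  (forall x y, x \in V -> y \in V -> adj x y -> side x != side y) ->
  bipartite (induced V).
Proof.
by move=> sideP; exists (side \o val) => -[x xV] [y yV] /= /sideP; apply.
Qed.

(** Deleting one side of a bipartition leaves an independent set, which is
    connected only if it has at most one vertex. *)
Lemma chromatically_connected3_not_bipartite (H : sgraph) :
  chromatically_connected3 H -> ~ bipartite H.
Proof.
move=> [card_H conH] [side sideP].
have small b : #|[set x | side x == b]| <= 1.
  have bipV : bipartite (induced [set x | side x == ~~ b]).
    apply: (@bipartite_induced _ _ side) => x y _ _; exact: sideP.
  have outE z : (z \notin [set x | side x == ~~ b]) = (side z == b).
    by rewrite inE; case: (side z) (b) => -[].
  apply/card_le1_eqP => x y; rewrite !inE => sx sy.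
  refine (@connected_delete_ind _ _ (eq y) (conH _ bipV) _ y x _ _ erefl);
    rewrite ?outE //.
  move=> u w; rewrite !outE => /eqP su /eqP sw /sideP.
  by rewrite su sw eqxx.
suff: #|H| <= 2 by rewrite leqNgt card_H.
rewrite -cardsT; have -> : [set: H] =
    [set x | side x == true] :|: [set x | side x == false].
  by apply/setP=> x; rewrite !inE; case: (side x).
apply: leq_trans (leq_card_setU _ _) _.
by rewrite (leq_add (small true) (small false)).
Qed.

(** A vertex with no neighbour would be a component by itself. *)
Lemma chromatically_connected3_neighbour (H : sgraph) (x : H) :
  chromatically_connected3 H -> exists y, adj x y.
Proof.
move=> [card_H conH].
have [y yx] : exists y, y \notin pred1 x.
  apply/existsP; rewrite -[[exists _, _]]negbK; apply/negP => /existsPn xT.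
  suff: #|H| <= 1 by rewrite leqNgt (leq_trans _ card_H).
  by rewrite -(card1 x); apply/subset_leq_card/subsetP => y _; rewrite -[_ \in _]negbK.
have conT : connected (delete_vertices (set0 : {set H})).
  by apply/conH/(@bipartite_induced _ _ predT) => u w; rewrite inE.
have [] : y = x \/ exists z, adj x z.
- refine (@connected_delete_ind _ _ (fun y => y = x \/ exists z, adj x z)
    conT _ x y _ _ _); rewrite ?inE //; last by left.
  by move=> u w _ _ uw [<-|]; right=> //; exists w.
- by move=> eyx; rewrite eyx inE eqxx in yx.
- by [].
Qed.

(** * The partite construction *)

Section Partite.
Variables (Pi K : finType) (rk : Pi -> nat).

(** Links are directed from lower to higher part, so that the two ends of the
    links of one type lie in two different, distinguishable parts. *)
Record pgraph := PGraph {
  pvertex :> finType;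
  part : pvertex -> Pi;
  link : K -> rel pvertex;
  link_rk : forall k x y, link k x y -> rk (part x) < rk (part y);
  link_uniq : forall k k' x y, link k x y -> link k' x y -> k = k' }.

Section Underlying.
Variable T : pgraph.

Definition underlying_adj : rel T :=
  fun x y => [exists k, link k x y || link k y x].

Lemma underlying_adj_sym : symmetric underlying_adj.
Proof. by move=> x y; apply: eq_existsb => k; rewrite orbC. Qed.

Lemma underlying_adj_irr : irreflexive underlying_adj.
Proof.
by move=> x; apply/existsP=> -[k]; rewrite orbb => /link_rk; rewrite ltnn.
Qed.

Definition underlying : sgraph := SGraph underlying_adj_sym underlying_adj_irr.
End Underlying.

Definition embedding (T T' : pgraph) (f : T -> T') :=
  [/\ injective f, forall x, part (f x) = part x &
      forall k x y, link k (f x) (f y) = link k x y].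

Lemma embedding_comp (T1 T2 T3 : pgraph) (f : T1 -> T2) (g : T2 -> T3) :
  embedding f -> embedding g -> embedding (g \o f).
Proof.
move=> [fI fp fl] [gI gp gl]; split=> [|x|k x y] /=; first exact: inj_comp.
- by rewrite gp fp.
- by rewrite gl fl.
Qed.

Lemma embedding_id (T : pgraph) : embedding (@id T).
Proof. by split. Qed.

Section Amalgam.
Variables (T : pgraph) (a b : Pi) (k0 : K) (n : nat).

Definition typed_link (p : T * T) :=
  [&& link k0 p.1 p.2, part p.1 == a & part p.2 == b].
Definition letter : finType := {p : T * T | typed_link p}.
Definition line : finType := {L : n.-tuple (option letter) | None \in L}.
Definition amalgam_vertex : finType := (n.-tuple T + line * T)%type.

(** The copy of T indexed by a line L shares with the other copies exactly its
    vertices in the parts a and b: such a vertex x becomes the word obtained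
    from L by putting x at the active coordinates and the end in the same part
    of the letter at the others. *)
Definition glue (pr : letter -> T) (L : line) (x : T) : n.-tuple T :=
  map_tuple (oapp pr x) (val L).

Definition copy (L : line) (x : T) : amalgam_vertex :=
  if part x == a then inl (glue (fun e => (val e).1) L x)
  else if part x == b then inl (glue (fun e => (val e).2) L x)
  else inr (L, x).

Definition amalgam_part (v : amalgam_vertex) : Pi :=
  match v with
  | inl u => if tval u is x :: _ then part x else a
  | inr p => part p.2
  end.

Definition amalgam_link (k : K) : rel amalgam_vertex := fun u w =>
  [exists L : line, exists x : T, exists y : T,
     [&& link k x y, u == copy L x & w == copy L y]].

Lemma amalgam_linkP k u w :
  reflect (exists L x y, [/\ link k x y, u = copy L x & w = copy L y])
          (amalgam_link k u w).
Proof.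
apply: (iffP existsP) => [[L /existsP[x /existsP[y /and3P[kxy /eqP-> /eqP->]]]]|].
  by exists L, x, y.
case=> L [x [y [kxy -> ->]]]; exists L; apply/existsP; exists x.
by apply/existsP; exists y; rewrite kxy !eqxx.
Qed.

Lemma head_glue pr (L : line) x :
  (forall e, part (pr e) = part x) -> amalgam_part (inl (glue pr L x)) = part x.
Proof.
move=> prP; case: L => -[[|[e|] L] szL] NL //=; exact: prP.
Qed.

Lemma letterP (e : letter) :
  [/\ link k0 (val e).1 (val e).2, part (val e).1 = a & part (val e).2 = b].
Proof. by case: e => p /= /and3P[? /eqP ? /eqP ?]. Qed.

Lemma part_copy L x : amalgam_part (copy L x) = part x.
Proof.
rewrite /copy; case: eqP => [xa|_].
  by rewrite head_glue // => e; have [_ ->] := letterP e.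
case: eqP => [xb|_] //.
by rewrite head_glue // => e; have [_ _ ->] := letterP e.
Qed.

Lemma line_active (L : line) : exists i, tnth (val L) i = None.
Proof. by case: L => L /= /tnthP[i ->]; exists i. Qed.

Lemma copy_coord L L' x x' i : copy L x = copy L' x' -> tnth (val L) i = None ->
  x = if tnth (val L') i is Some e
      then if part x == a then (val e).1 else (val e).2 else x'.
Proof.
move=> eqx Li; have px : part x = part x' by rewrite -(part_copy L) eqx part_copy.
move: eqx; rewrite /copy -px.
have coord pr : glue pr L x = glue pr L' x' -> x = oapp pr x' (tnth (val L') i).
  by move/(congr1 (fun t => tnth t i)); rewrite !tnth_map Li.
have inlI : injective (inl : _ -> amalgam_vertex) by move=> u w [].
case: eqP => _; first by move/inlI; apply: coord.
by case: eqP => _; [move/inlI; apply: coord | case=> <-; rewrite Li].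
Qed.

Lemma copy_inj L : injective (copy L).
Proof.
move=> x x' eqx; have [i Li] := line_active L.
by have := copy_coord eqx Li; rewrite Li.
Qed.

(** If a pair of vertices is shared by two copies, then at a coordinate active
    for the first line the second copy shows either the same pair or the two
    ends of a letter. This is why the copies are induced subgraphs of their
    union, with the same labels. *)
Lemma copy_common L L' x y x' y' : rk (part x) < rk (part y) ->
  copy L x = copy L' x' -> copy L y = copy L' y' ->
  (x = x' /\ y = y') \/ link k0 x y.
Proof.
move=> lt_xy eqx eqy; have [i Li] := line_active L.
move: (copy_coord eqx Li) (copy_coord eqy Li).
case: (tnth _ i) => [e|]; last by left.
have [e12 e1 e2] := letterP e; move=> xe ye; right.
have lt_ab : rk a < rk b by rewrite -e1 -e2; apply: link_rk e12.
move: xe ye lt_xy; case: eqP => [xa|_ ->]; case: eqP => [ya|_ ->].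
- by rewrite xa ya ltnn.
- by move->.
- by rewrite e2 ya ltnNge ltnW.
- by rewrite ltnn.
Qed.

Lemma amalgam_link_rk k u w :
  amalgam_link k u w -> rk (amalgam_part u) < rk (amalgam_part w).
Proof.
case/amalgam_linkP=> L [x [y [kxy -> ->]]].
by rewrite !part_copy; apply: link_rk kxy.
Qed.

Lemma amalgam_link_uniq k k' u w :
  amalgam_link k u w -> amalgam_link k' u w -> k = k'.
Proof.
case/amalgam_linkP=> L [x [y [kxy -> ->]]].
case/amalgam_linkP=> L' [x' [y' [kxy' eqx eqy]]].
have [[ex ey]|k0xy] := copy_common (link_rk kxy) eqx eqy.
  by subst; apply: link_uniq kxy kxy'.
have [[ex ey]|k0xy'] := copy_common (link_rk kxy') (esym eqx) (esym eqy).
  by subst; apply: link_uniq kxy kxy'.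
by rewrite (link_uniq kxy k0xy) (link_uniq kxy' k0xy').
Qed.

Definition amalgam : pgraph := PGraph amalgam_link_rk amalgam_link_uniq.

Lemma copy_embedding L : embedding (copy L : T -> amalgam).
Proof.
split=> [|x|k x y]; [exact: copy_inj | exact: part_copy |].
apply/amalgam_linkP/idP => [[L' [x' [y' [kxy' eqx eqy]]]]|kxy]; last first.
  by exists L, x, y.
have [[<- <-]|k0xy'] // := copy_common (link_rk kxy') (esym eqx) (esym eqy).
have lt_xy : rk (part x) < rk (part y).
  rewrite -(part_copy L) -[part y](part_copy L) eqx eqy !part_copy.
  exact: link_rk kxy'.
have [[-> ->]|k0xy] // := copy_common lt_xy eqx eqy.
by rewrite (link_uniq kxy' k0xy').
Qed.

(** The vertices of J mapped to shared vertices induce a bipartite graph, since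
    there are only two shared parts. Deleting them leaves J connected, so the
    rest of J lies in a single copy. Deleting all of them but j shows that j has
    a neighbour in that rest, so j too belongs to that copy. *)
Lemma amalgam_hom (J : sgraph) (f : J -> underlying amalgam) :
  chromatically_connected3 J -> graph_hom f ->
  exists L (f' : J -> T), f =1 copy L \o f'.
Proof.
move=> J3 fhom; have [_ conJ] := J3.
pose shared j := if f j is inl _ then true else false.
pose V := [set j | shared j].
have sharedP k u w (u' w' : n.-tuple T) : amalgam_link k u w ->
    u = inl u' -> w = inl w' -> (amalgam_part u == a) != (amalgam_part w == a).
  case/amalgam_linkP=> L [x [y [/link_rk lt_xy -> ->]]].
  rewrite !part_copy /copy.
  case: (part x =P a) => [xa|_]; case: (part y =P a) => [ya|_] //.
    by rewrite xa ya ltnn in lt_xy.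
  by case: (part x =P b) => [xb|//]; case: (part y =P b) => [yb|//];
    rewrite xb yb ltnn in lt_xy.
have sideP x y : x \in V -> y \in V -> adj x y ->
    (amalgam_part (f x) == a) != (amalgam_part (f y) == a).
  rewrite !inE /shared => xV yV /fhom/existsP[k].
  case fx : (f x) xV => [u|] // _; case fy : (f y) yV => [w|] // _.
  by case/orP=> /sharedP/(_ erefl erefl) //; rewrite eq_sym.
have subV (W : {set J}) : W \subset V -> connected (delete_vertices W).
  move=> sWV; apply: conJ.
  apply: (@bipartite_induced _ _ (fun j => amalgam_part (f j) == a)).
  by move=> x y /(subsetP sWV) xV /(subsetP sWV) yV; apply: sideP.
have [j0 j0V] : exists j0, j0 \notin V.
  case: (boolP [exists j, j \notin V]) => [/existsP//|/existsPn VT].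
  case: (chromatically_connected3_not_bipartite J3).
  exists (fun j => amalgam_part (f j) == a) => x y.
  by apply: sideP; rewrite -[_ \in _]negbK VT.
case f0 : (f j0) => [u0|[L x0]]; first by rewrite inE /shared f0 in j0V.
have outL j : j \notin V -> exists x, f j = inr (L, x).
  move=> jV; refine (@connected_delete_ind _ _ (fun j => exists x, f j = inr (L, x))
    (subV V (subxx V)) _ j0 j j0V jV _); last by exists x0.
  move=> x y xV yV /fhom xy [z fx]; move: yV xy; rewrite inE /shared fx.
  case fy : (f y) => [//|[L' z']] _ /existsP[k /orP[]] /amalgam_linkP.
    case=> M [p [p' [_]]]; rewrite /copy; do 4 case: eqP => _ //.
    by case=> <- _ [-> _]; exists z'.
  case=> M [p [p' [_]]]; rewrite /copy; do 4 case: eqP => _ //.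
  by case=> -> _ [<- _]; exists z'.
have inL j : exists x, f j = copy L x.
  have copyE x M p : inr (L, x) = copy M p -> inr (L, x) = copy L p.
    by rewrite /copy; do 2 case: (_ =P _) => _ //; case=> _ ->.
  have copyL x M p : inr (L, x) = copy M p -> M = L.
    by rewrite /copy; do 2 case: (_ =P _) => _ //; case.
  have nbr x : adj (f j) (inr (L, x) : underlying amalgam) ->
      exists y, f j = copy L y.
    by move=> /existsP[k /orP[]] /amalgam_linkP[M [p [p' [_]]]];
      [move=> -> /copyL-> | move=> /copyL-> ->]; eexists.
  have [jV|/outL[x fj]] := boolP (j \in V); last first.
    have [z /fhom] := chromatically_connected3_neighbour j J3.
    rewrite fj => /existsP[k /orP[]] /amalgam_linkP[M [p [p' [_]]]].
      by move=> /copyE-> _; exists p.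
    by move=> _ /copyE->; exists p'.
  pose W := V :\ j.
  have [ej0|//] : j0 = j \/ exists y, f j = copy L y; last by rewrite ej0 jV in j0V.
  refine (@connected_delete_ind _ W (fun z => z = j \/ exists y, f j = copy L y)
    (subV W (subD1set _ _)) _ j j0 _ _ _);
    rewrite ?in_setD1 ?eqxx ?(negPf j0V) ?andbF //; last by left.
  move=> x y _ yW xy [exj|]; right=> //; move: xy yW.
  rewrite exj in_setD1; case: eqP => [->|_ /= jy /outL[z fy]]; first by rewrite adj_irr.
  by move: (fhom _ _ jy); rewrite fy; apply: nbr.
have [f' ff'] := fin_all_exists inL.
by exists L, f'.
Qed.
End Amalgam.

Definition hom_universal (T T' : pgraph) :=
  forall (J : sgraph) (f : J -> underlying T'),
  chromatically_connected3 J -> graph_hom f ->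
  exists (g : T -> T') (f' : J -> T), embedding g /\ f =1 g \o f'.

Definition type_mono (C : Type) (T : pgraph) (c : T -> T -> C) a b k :=
  forall x y x' y', typed_link a b k (x, y) -> typed_link a b k (x', y') ->
  c x y = c x' y'.

(** A word of links of one type is coloured through the pair of words formed by
    its ends; a monochromatic line is then a copy whose links of this type all
    have the same colour. *)
Lemma partite_step (T : pgraph) a b k (C : finType) : exists T' : pgraph,
  hom_universal T T' /\
  forall c : T' -> T' -> C, exists f : T -> T', embedding f /\
    type_mono (fun x y => c (f x) (f y)) a b k.
Proof.
pose E := letter T a b k.
have [n HJ] := Hales_Jewett (enum E) (option C : finType).
exists (amalgam T a b k n); split.
  move=> J f J3 /(amalgam_hom J3)[L [f' ff']].
  by exists (copy L), f'; split=> //; apply: copy_embedding.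
move=> c; pose tup w : option (n.-tuple T) := insub w.
have [L [/eqP szL NL monoL]] := HJ (fun w : seq E =>
  match tup [seq (val e).1 | e <- w], tup [seq (val e).2 | e <- w] with
  | Some u, Some v => Some (c (inl u) (inl v)) | _, _ => None end).
pose M : line T a b k n := exist _ (Tuple szL) NL.
exists (copy M); split; first exact: copy_embedding.
have cE (e : E) : match tup [seq (val e).1 | e <- instantiate L e],
    tup [seq (val e).2 | e <- instantiate L e] with
  | Some u, Some v => Some (c (inl u) (inl v)) | _, _ => None end =
  Some (c (copy M (val e).1) (copy M (val e).2)).
  have [e12 e1 e2] := letterP e.
  have ba : (b == a) = false.
    by apply/eqP=> ba; have := link_rk e12; rewrite e1 e2 ba ltnn.
  have -> : [seq (val e).1 | e <- instantiate L e] = glue (fun e => (val e).1) M (val e).1.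
    by rewrite -map_comp; apply: eq_map => -[].
  have -> : [seq (val e).2 | e <- instantiate L e] = glue (fun e => (val e).2) M (val e).2.
    by rewrite -map_comp; apply: eq_map => -[].
  by rewrite /tup !valK /copy e1 e2 ba !eqxx.
move=> x y x' y' xy xy'.
have := monoL (exist _ (x, y) xy) (exist _ (x', y') xy').
by rewrite !mem_enum => /(_ isT isT); rewrite !cE => -[].
Qed.

(** The types are treated one after the other; on a copy of T inside a copy of
    the previous graph, the types treated before stay monochromatic because
    embeddings preserve types. *)
Theorem partite_construction (T : pgraph) (C : finType) : exists T' : pgraph,
  hom_universal T T' /\
  forall c : T' -> T' -> C, exists f : T -> T', embedding f /\
    forall a b k, type_mono (fun x y => c (f x) (f y)) a b k.
Proof.
suff [T' [homT' monoT']] : exists T' : pgraph, hom_universal T T' /\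
    forall c : T' -> T' -> C, exists f : T -> T', embedding f /\
    forall t, t \in enum {: Pi * Pi * K} ->
      type_mono (fun x y => c (f x) (f y)) t.1.1 t.1.2 t.2.
  exists T'; split=> // c; have [f [fE fm]] := monoT' c; exists f; split=> // a b k.
  exact: (fm (a, b, k)) (mem_enum _ _).
elim: (enum _) => [|t ts [T1 [hom1 mono1]]].
  exists T; split=> [J f J3 fhom|c]; last by exists id; split=> //; apply: embedding_id.
  by exists id, f; split=> //; apply: embedding_id.
have [T2 [hom2 mono2]] := partite_step T1 t.1.1 t.1.2 t.2 C.
exists T2; split=> [J f J3 fhom|c].
  have [g2 [f1 [g2E fE]]] := hom2 J f J3 fhom.
  have f1hom : graph_hom (f1 : J -> underlying T1).
    move=> x y /fhom /existsP[k]; rewrite !fE /=.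
    have [_ _ lk] := g2E; rewrite !lk => xy.
    by apply/existsP; exists k.
  have [g1 [f' [g1E f1E]]] := hom1 J f1 J3 f1hom.
  exists (g2 \o g1), f'; split; first exact: embedding_comp.
  by move=> x; rewrite /= fE /= f1E.
have [f2 [f2E m2]] := mono2 c.
have [f1 [f1E m1]] := mono1 (fun x y => c (f2 x) (f2 y)).
exists (f2 \o f1); split; first exact: embedding_comp.
move=> t'; rewrite inE => /orP[/eqP-> x y x' y' xy xy'|/m1] //.
have [_ pf lk] := f1E.
by apply: m2; rewrite /typed_link /= lk !pf.
Qed.
End Partite.

(** * Patterns *)

Section Template.
Variables (r' s q' : nat).
Notation r := r'.+2.
Notation q := q'.+3.

Definition tint (A : {set 'I_s}) (i : 'I_s) : 'I_r :=
  if i \in A then ord0 else ord_max.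

Definition few (A A' : {set 'I_s}) (k : 'I_r) :=
  #|[set i | (tint A i == k) && (tint A' i == k)]| <= 1.

(** Suppose that no such A, A', k exist. The empty set is not sent to colour 0
    and the full set not to colour 1, nor any set to a third colour. Take A
    minimal of colour 0 and x in A. Then A minus x has colour 1, and the
    complement of A together with x meets A only in x but covers the complement
    of A minus x, so it can have neither of the two colours. *)
Lemma few_clash (mu : {set 'I_s} -> 'I_r) :
  exists A A' k, [/\ mu A = k, mu A' = k & few A A' k].
Proof.
have empty A A' k : (forall i, tint A i = k -> tint A' i = k -> False) -> few A A' k.
  move=> H; rewrite /few; suff -> : [set i | (tint A i == k) && (tint A' i == k)] = set0.
    by rewrite cards0.
  by apply/setP=> i; rewrite !inE; apply/andP=> -[/eqP hi /eqP]; apply: H.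
have [mu0|mu0] := eqVneq (mu set0) ord0.
  by exists set0, set0, ord0; split=> //; apply: empty => i; rewrite /tint inE.
have [/existsP[A mA]|/existsPn no0] := boolP [exists A, mu A == ord0]; last first.
  have [muT|muT] := eqVneq (mu setT) ord_max.
    by exists setT, setT, ord_max; split=> //; apply: empty => i; rewrite /tint inE.
  exists setT, setT, (mu setT); split=> //; apply: empty => i; rewrite /tint inE.
  by move=> e; have := no0 setT; rewrite -e eqxx.
case: (@arg_minnP _ A (fun A => mu A == ord0) (fun A : {set 'I_s} => #|A|) mA)
  => {mA} {}A /eqP mA minA.
have /set0Pn[x xA] : A != set0 by apply: contraNneq mu0 => <-; rewrite mA.
have mAx : mu (A :\ x) != ord0.
  by apply/negP=> /minA; rewrite [in leqLHS](cardsD1 x) xA ltnn.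
have [muAx|muAx] := eqVneq (mu (A :\ x)) ord_max; last first.
  exists (A :\ x), (A :\ x), (mu (A :\ x)); split=> //; apply: empty => i.
  by rewrite /tint; case: ifP => _ e; [rewrite -e eqxx in mAx | rewrite -e eqxx in muAx].
pose B := x |: ~: A.
have [muB|muB] := eqVneq (mu B) ord0.
  exists A, B, ord0; split=> //; rewrite /few.
  suff -> : [set i | (tint A i == ord0) && (tint B i == ord0)] = [set x].
    by rewrite cards1.
  apply/setP=> i; rewrite /tint !inE; have [->|ix] /= := eqVneq i x; first by rewrite xA.
  by case: (i \in A).
have [muB'|muB'] := eqVneq (mu B) ord_max; last first.
  exists B, B, (mu B); split=> //; apply: empty => i.
  by rewrite /tint; case: ifP => _ e; [rewrite -e eqxx in muB | rewrite -e eqxx in muB'].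
exists (A :\ x), B, ord_max; split=> //; apply: empty => i.
by rewrite /tint !inE; have [->|ix] /= := eqVneq i x; last case: (i \in A).
Qed.

(** [None] is the type of the distinguished vertices; the other types are pairs
    of a position below N and, possibly, a set of copy indices. *)
Definition ptype N : finType := option ('I_N * option {set 'I_s}).

Definition ptype_rk N (p : ptype N) : nat := if p is Some (a, _) then a.+1 else 0.

(** The colour in the blow-up of a link from part p to part p' with label k,
    over the copy index i of its lower end. *)
Definition link_colour N (i : 'I_s) (p p' : ptype N) (k : 'I_r) : 'I_r :=
  match p, p' with None, Some (_, Some A) => tint A i | _, _ => k end.

(** The predicate [allowed] restricts the links between types carrying sets; it
    matters for the triangle, where a distinguished vertex will be adjacent to
    all vertices carrying a set. *)
Variable allowed : {set 'I_s} -> {set 'I_s} -> 'I_r -> bool.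

Definition link_ok N (p p' : ptype N) (k : 'I_r) : bool :=
  match p, p' with
  | None, Some (_, Some _) => true
  | None, _ => false
  | Some (_, Some A), Some (_, Some A') => allowed A A' k
  | _, _ => true
  end.

(** The types of the q classes, and the labels of the links between them. *)
Definition pattern N : finType :=
  ({ffun 'I_q -> ptype N} * {ffun 'I_q * 'I_q -> 'I_r})%type.

(** The complete q-partite graph shaped by t is monochromatic of colour k in the
    blow-up, when the distinguished class sits over the index i. *)
Definition mono_at N (t : pattern N) (k : 'I_r) (i : 'I_s) :=
  [forall c : 'I_q, forall c' : 'I_q, (c < c') ==>
     (link_colour i (t.1 c) (t.1 c') (t.2 (c, c')) == k)].

Definition valid N (t : pattern N) :=
  [forall c : 'I_q, forall c' : 'I_q, (c < c') ==>
     (ptype_rk (t.1 c) < ptype_rk (t.1 c')) &&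
     link_ok (t.1 c) (t.1 c') (t.2 (c, c'))] &&
  [forall k, #|[set i | mono_at t k i]| <= 1].

Lemma mono_atP N (t : pattern N) k i :
  reflect (forall c c' : 'I_q, c < c' ->
             link_colour i (t.1 c) (t.1 c') (t.2 (c, c')) = k) (mono_at t k i).
Proof.
apply: (iffP forallP) => [H c c' cc'|H c].
  by have /forallP/(_ c') := H c; rewrite cc' => /eqP.
by apply/forallP=> c'; apply/implyP=> cc'; rewrite H.
Qed.

Lemma validP N (t : pattern N) :
  reflect ((forall c c' : 'I_q, c < c' ->
              ptype_rk (t.1 c) < ptype_rk (t.1 c') /\
              link_ok (t.1 c) (t.1 c') (t.2 (c, c'))) /\
           (forall k i i', mono_at t k i -> mono_at t k i' -> i = i'))
          (valid t).
Proof.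
apply: (iffP andP) => -[H1 H2]; split.
- by move=> c c' cc'; have /forallP/(_ c) /forallP/(_ c') := H1; rewrite cc' => /andP.
- move=> k i i' mi mi'; have /forallP/(_ k) /card_le1_eqP := H2.
  by apply; rewrite inE.
- apply/forallP=> c; apply/forallP=> c'; apply/implyP=> cc'.
  by have [-> ->] := H1 _ _ cc'.
- apply/forallP=> k; apply/card_le1_eqP => i i'; rewrite !inE => mi mi'.
  exact: H2 mi' mi.
Qed.

(** In a pattern with a distinguished class, one class carries A and the q - 2
    others carry A', so A' is linked to itself once q exceeds 3. *)
Hypothesis allowedP : forall A A' k, few A A' k ->
  allowed A A' k /\ (0 < q' -> allowed A' A' k).

Definition has_mono_pattern N (g : ptype N -> ptype N -> 'I_r -> 'I_r) :=
  exists (t : pattern N) (k : 'I_r), valid t /\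
    forall c c' : 'I_q, c < c' -> g (t.1 c) (t.1 c') (t.2 (c, c')) = k.

(** By Ramsey's theorem the positions can be taken not to matter. A pattern
    avoiding the distinguished type is valid as soon as two of its labels differ
    and its links are allowed; such patterns without sets force g to act on
    the labels by a permutation gam, and those with one or two classes carrying sets
    force the same permutation on the links of these classes. What remains is
    the colour mu of the links from the distinguished type to the sets, to
    which [few_clash] applies after undoing gam. *)
Theorem mono_pattern : exists N, forall g : ptype N -> ptype N -> 'I_r -> 'I_r,
  has_mono_pattern g.
Proof.
have [N HN] := ramsey
  ({ffun option {set 'I_s} * option {set 'I_s} * 'I_r -> 'I_r} *
   {ffun {set 'I_s} -> 'I_r})%type q.+1.
exists N => g.
have [[G mu] [th' thP']] := HN (fun a b : 'I_N =>
  ([ffun x => g (Some (a, x.1.1)) (Some (b, x.1.2)) x.2],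
   [ffun A => g None (Some (a, Some A)) ord0])).
pose th (c : 'I_q) := th' (widen_ord (leqnSn _) c).
have thP (c c' : 'I_q) : c < c' -> th c < th c' by move=> cc'; apply: (thP' _ _ _).1.
have GE (c c' : 'I_q) x x' k : c < c' -> g (Some (th c, x)) (Some (th c', x')) k = G (x, x', k).
  move=> cc'; have [_ [eqG _]] :=
    thP' (widen_ord (leqnSn _) c) (widen_ord (leqnSn _) c') cc'.
  by have /ffunP/(_ (x, x', k)) := eqG; rewrite ffunE.
have muE c A : g None (Some (th c, Some A)) ord0 = mu A.
  have [|_ [_ eqmu]] := thP' (widen_ord (leqnSn _) c) ord_max; first exact: (ltn_ord c).
  by have /ffunP/(_ A) := eqmu; rewrite ffunE.
pose i0 : 'I_q := ord0; pose i1 : 'I_q := Ordinal (isT : 1 < q).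
pose i2 : 'I_q := Ordinal (isT : 2 < q).
(* Patterns avoiding the distinguished type: two different labels suffice for
   validity. *)
have inner (x : 'I_q -> option {set 'I_s}) (kk : 'I_q -> 'I_q -> 'I_r) k :
    (forall c c' : 'I_q, c < c' -> G (x c, x c', kk c c') = k) ->
    (forall c c' : 'I_q, c < c' -> link_ok (Some (th c, x c)) (Some (th c', x c')) (kk c c')) ->
    kk i0 i1 != kk i1 i2 -> has_mono_pattern g.
  move=> Gk ok kk_neq.
  exists ([ffun c => Some (th c, x c)], [ffun cc => kk cc.1 cc.2]), k; split.
    apply/validP; split=> [c c' cc'|l i i' /mono_atP mi]; rewrite ?ffunE /=.
      by rewrite ltnS; split; [apply: thP | apply: ok].
    have := mi i1 i2 isT; have := mi i0 i1 isT; rewrite !ffunE /= => <- e.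
    by rewrite e eqxx in kk_neq.
  by move=> c c' cc'; rewrite !ffunE /= GE // Gk.
pose gam k := G (None, None, k).
pose star k k' (c c' : 'I_q) : 'I_r := if val c is 0 then k else k'.
pose edge k k' (c c' : 'I_q) : 'I_r :=
  match val c, val c' with 0, 1 => k | _, _ => k' end.
have [gam_inj|] := boolP (injectiveb gam); last first.
  case/injectivePn=> k [k' kk' ek]; apply: (inner (fun=> None) (star k k') (gam k)) => //.
  by move=> c c' _; rewrite /star; case: (val c).
have gam_surj l : exists k, gam k = l.
  by have [h hK Kh] := injF_bij (injectiveP _ gam_inj); exists (h l).
have [/forallP bot_link|/forallPn[A /forallPn[k /eqP nGk]]] :=
    boolP [forall A, forall k, G (Some A, None, k) == gam k]; last first.
  have [k' ek'] := gam_surj (G (Some A, None, k)).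
  have kk' : k != k' by apply/eqP=> kk'; case: nGk; rewrite -ek' kk'.
  apply: (inner (fun c => if val c is 0 then Some A else None) (star k k') (gam k')) => //.
    by move=> [[|c] hc] [[|c'] hc'].
  by move=> [[|c] hc] [[|c'] hc'].
have {}bot_link A k : G (Some A, None, k) = gam k.
  by apply/eqP; move/forallP: (bot_link A); apply.
have [/'forall_forallP set_link|] := boolP [forall A, forall A',
    [forall k, allowed A A' k ==> (G (Some A, Some A', k) == gam k)]]; last first.
  case/forallPn=> A /forallPn[A' /forallPn[k]]; rewrite negb_imply => /andP[okA /eqP nGk].
  have [k' ek'] := gam_surj (G (Some A, Some A', k)).
  have kk' : k != k' by apply/eqP=> kk'; case: nGk; rewrite -ek' kk'.
  apply: (inner (fun c => match val c with 0 => Some A | 1 => Some A' | _ => None end)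
                (edge k k') (gam k')) => //.
    by move=> [[|[|c]] hc] [[|[|c']] hc'] //= _; rewrite /edge /= ?bot_link.
  by move=> [[|[|c]] hc] [[|[|c']] hc'].
have {}set_link A A' k : allowed A A' k -> G (Some A, Some A', k) = gam k.
  by move=> okA; have /forallP/(_ k) := set_link A A'; rewrite okA => /eqP.
have [gam' gamK' gamK] := injF_bij (injectiveP _ gam_inj).
have [A [A' [k [muA muA' fewA]]]] := few_clash (gam' \o mu).
have {}muA : mu A = gam k by rewrite -muA /= gamK.
have {}muA' : mu A' = gam k by rewrite -muA' /= gamK.
have [okA okA'] := allowedP fewA.
have okq c c' : c.+2 < c'.+2 -> c'.+2 < q -> 0 < q'.
  by move=> cc' hc'; apply: leq_trans (leq_ltn_trans (leq0n c) cc') hc'.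
(* The pattern with a distinguished class, provided by the clash. *)
pose x (c : 'I_q) : ptype N :=
  match val c with 0 => None | 1 => Some (th c, Some A) | _ => Some (th c, Some A') end.
pose kk (c c' : 'I_q) : 'I_r := if val c is 0 then ord0 else k.
exists ([ffun c => x c], [ffun cc => kk cc.1 cc.2]), (gam k); split; last first.
  move=> c c' cc'; rewrite !ffunE /=; move: cc'.
  case: c => [[|[|c]] hc]; case: c' => [[|[|c']] hc'] //= cc'.
  - by rewrite /x /kk /= muE.
  - by rewrite /x /kk /= muE.
  - by rewrite /x /kk /= GE // set_link.
  - by rewrite /x /kk /= GE // set_link //; apply: okA' (okq _ _ cc' hc').
apply/validP; split=> [c c' cc'|l i i' /mono_atP mi /mono_atP mi'].
  rewrite !ffunE /=; move: cc'.
  case: c => [[|[|c]] hc]; case: c' => [[|[|c']] hc'] //= cc';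
    (split; first by rewrite ?ltnS // thP).
  - exact: okA.
  - exact: okA' (okq _ _ cc' hc').
have kl : k = l by have := mi i1 i2 isT; rewrite !ffunE.
have in_few j : (forall c c' : 'I_q, c < c' -> link_colour j ([ffun c => x c] c)
      ([ffun c => x c] c') ([ffun cc => kk cc.1 cc.2] (c, c')) = l) ->
    j \in [set i | (tint A i == k) && (tint A' i == k)].
  move=> mj; rewrite inE; have := mj i0 i1 isT; have := mj i0 i2 isT.
  by rewrite !ffunE /= => -> ->; rewrite kl eqxx.
by move/card_le1_eqP: fewA; apply; apply: in_few.
Qed.
End Template.

(** * Blow-ups of chromatically connected graphs *)

Lemma bipartite_inducedP (H : sgraph) (V : {set H}) : bipartite (induced V) ->
  exists side : H -> bool,
    forall x y, x \in V -> y \in V -> adj x y -> side x != side y.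
Proof.
case=> side sideP; exists (fun x => oapp side false (insub x)) => x y xV yV xy.
rewrite (insubT (fun x => x \in V) xV) (insubT (fun x => x \in V) yV) /=.
exact: sideP.
Qed.

(** Deleting h together with one side of the rest leaves the other side, an
    independent set, which therefore has at most one vertex. *)
Lemma card_bipartite_delete_vertex (H : sgraph) (h : H) (side : H -> bool) :
  chromatically_connected3 H ->
  (forall x y, x != h -> y != h -> adj x y -> side x != side y) -> #|H| = 3.
Proof.
move=> [card_H conH] sideP.
have small b : #|[set x | (x != h) && (side x == b)]| <= 1.
  pose V := [set x | (x == h) || (side x != b)].
  have bipV : bipartite (induced V).
    apply: (@bipartite_induced _ _ (pred1 h)) => x y; rewrite !inE /=.
    have [->|xh] /= := eqVneq x h; have [->|yh] //= := eqVneq y h.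
      by rewrite adj_irr.
    by move=> + + /(sideP _ _ xh yh); case: (side x) (side y) (b) => [] [] [].
  have outE z : (z \notin V) = (z != h) && (side z == b).
    by rewrite inE negb_or negbK.
  apply/card_le1_eqP => x y; rewrite !inE => hx hy.
  refine (@connected_delete_ind _ _ (eq y) (conH _ bipV) _ y x _ _ erefl);
    rewrite ?outE //.
  move=> u w; rewrite !outE => /andP[uh /eqP su] /andP[wh /eqP sw] /(sideP _ _ uh wh).
  by rewrite su sw eqxx.
apply/eqP; rewrite eqn_leq card_H andbT -cardsT.
have -> : [set: H] = h |: ([set x | (x != h) && (side x == true)] :|:
                           [set x | (x != h) && (side x == false)]).
  by apply/setP=> x; rewrite !inE; case: eqP => //= _; case: (side x).
apply: leq_trans (leq_card_setU _ _) _; rewrite cards1.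
by rewrite (leq_add (leqnn 1) (leq_trans (leq_card_setU _ _) (leq_add (small _) (small _)))).
Qed.

(** Only the vertices of H both of whose copies are deleted matter; they induce a
    bipartite graph, so the others form a connected graph. Two remaining copies
    of one vertex h are joined through a neighbour of h, which exists unless h
    is the only vertex left; but then H minus h is bipartite and H is a
    triangle. *)
Lemma chromatically_connected3_blowup2 (H : sgraph) :
  chromatically_connected3 H -> #|H| != 3 -> chromatically_connected3 (blowup H 2).
Proof.
move=> H3 card_H; have [le3H conH] := H3; split.
  by rewrite card_prod card_ord (leq_trans le3H) // leq_pmulr.
move=> V /bipartite_inducedP[side sideP].
pose W := [set h : H | [forall b : 'I_2, ((h, b) : blowup H 2) \in V]].
have conW : connected (delete_vertices W).
  apply: conH; apply: (@bipartite_induced _ _ (fun h => side (h, ord0))) => x y.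
  by rewrite !inE => /forallP xV /forallP yV xy; apply: sideP.
have outW h b : ((h, b) : blowup H 2) \notin V -> h \notin W.
  by apply: contraNN; rewrite inE => /forallP.
have nbr h : h \notin W -> exists2 g, g \notin W & adj h g.
  move=> hW.
  have [/existsP[g /andP[gW gh]]|/existsPn W_h] :=
      boolP [exists g, (g \notin W) && (g != h)]; last first.
    case/eqP: card_H.
    apply: (@card_bipartite_delete_vertex H h (fun h => side (h, ord0))) => // x y xh yh xy.
    have inW z : z != h -> z \in W.
      by move=> zh; have := W_h z; rewrite zh andbT negbK.
    apply: sideP => //; [move: (inW x xh) | move: (inW y yh)];
      by rewrite inE => /forallP.
  have [] : g = h \/ exists2 g, g \notin W & adj h g; last by [].
    refine (@connected_delete_ind _ W (fun g => g = h \/ _) conW _ h g hW gW _);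
      last by left.
    by move=> u w uW wW uw [<-|]; right=> //; exists w.
  by move=> egh; rewrite egh eqxx in gh.
move=> [[h0 b0] x0V] [[h1 b1] x1V].
have x0V' : ((h0, b0) : blowup H 2) \notin V by rewrite -in_setC.
have x1V' : ((h1, b1) : blowup H 2) \notin V by rewrite -in_setC.
have edge g c g' c' (gV : ((g, c) : blowup H 2) \in ~: V)
    (gV' : ((g', c') : blowup H 2) \in ~: V) : adj g g' ->
    connect (@adj (delete_vertices V)) (exist _ (g, c) gV) (exist _ (g', c') gV').
  by move=> gg'; apply: connect1.
have somecopy g : g \notin W -> exists c, ((g, c) : blowup H 2) \in ~: V.
  by rewrite inE => /forallPn[c gc]; exists c; rewrite inE.
pose P g := forall c (gV : ((g, c) : blowup H 2) \in ~: V),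
  connect (@adj (delete_vertices V)) (exist _ (h0, b0) x0V) (exist _ (g, c) gV).
suff: P h1 by apply.
apply: (connected_delete_ind conW (P := P)) (outW _ _ x0V') (outW _ _ x1V') _.
  move=> u w uW wW uw Pu c wV; have [c' uV] := somecopy _ uW.
  exact: connect_trans (Pu _ uV) (edge _ _ _ _ _ _ uw).
move=> c gV; have [g gW h0g] := nbr _ (outW _ _ x0V').
have [c' gV'] := somecopy _ gW.
apply: connect_trans (edge _ _ _ _ x0V gV' h0g) (edge _ _ _ _ gV' gV _).
by rewrite adj_sym.
Qed.

Lemma card3_complete (H : sgraph) (x y : H) :
  chromatically_connected3 H -> #|H| = 3 -> x != y -> adj x y.
Proof.
move=> [_ conH] card_H xy; pose V := ~: [set x; y].
have cardV : #|V| <= 1 by rewrite cardsCs setCK card_H cards2 xy.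
have bipV : bipartite (induced V).
  apply: (@bipartite_induced _ _ predT) => u w uV wV.
  by have /card_le1_eqP/(_ _ _ uV wV)-> := cardV; rewrite adj_irr.
have [] : y = x \/ adj x y; last by [].
  refine (@connected_delete_ind _ V (fun z => z = x \/ adj x y) (conH _ bipV)
    _ x y _ _ _); rewrite ?inE ?negbK ?eqxx ?orbT //; last by left.
  move=> u w _; rewrite !inE negbK => /orP[/eqP->|/eqP->]; first by left.
  by move=> uw [ux|]; right=> //; rewrite -ux.
by move=> yx; rewrite yx eqxx in xy.
Qed.

(** Colours of edges, which are unordered pairs, may be prescribed through an
    orientation. *)
Lemma oriented_colouring (V : finType) (C : Type) (m : V -> nat) (D : V -> V -> C) :
  C -> exists c : {set V} -> C, forall x y, m x < m y -> c [set x; y] = D x y.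
Proof.
move=> c0; exists (fun S => if [pick z : V * V | (m z.1 < m z.2) && (S == [set z.1; z.2])]
  is Some z then D z.1 z.2 else c0) => x y xy.
case: pickP => [[x' y'] /= /andP[xy' /eqP eS]|/(_ (x, y))]; last by rewrite xy eqxx.
have : x \in [set x'; y'] by rewrite -eS set21.
have : y \in [set x'; y'] by rewrite -eS set22.
rewrite !inE => /orP[]/eqP ey /orP[]/eqP ex; subst=> //.
- by rewrite ltnn in xy.
- by rewrite ltnNge ltnW in xy.
- by rewrite ltnn in xy.
Qed.

(** * Graphs other than the triangle *)

Section PatternGraph.
Variables (r' s q' N : nat) (allowed : {set 'I_s} -> {set 'I_s} -> 'I_r'.+2 -> bool).
Variables (H : sgraph) (kappa : H -> 'I_q'.+3).
Notation r := r'.+2.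
Notation q := q'.+3.

(** The disjoint union of one copy of H for each valid pattern, the vertices of
    H being placed according to their class. The copies of H for the other
    patterns are kept as isolated vertices. *)
Definition pattern_vertex : finType := (pattern r' s q' N * H)%type.

Definition pattern_part (x : pattern_vertex) : ptype s N := x.1.1 (kappa x.2).

Definition pattern_link (k : 'I_r) : rel pattern_vertex := fun x y =>
  [&& x.1 == y.1, valid allowed x.1, adj x.2 y.2, kappa x.2 < kappa y.2 &
      x.1.2 (kappa x.2, kappa y.2) == k].

Lemma pattern_link_rk k x y : pattern_link k x y ->
  ptype_rk (pattern_part x) < ptype_rk (pattern_part y).
Proof.
case: x y => [t h] [t' h'] /and5P[/= /eqP <- /validP[vt _] _ hh' _].
exact: (vt _ _ hh').1.
Qed.

Lemma pattern_link_uniq k k' x y :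
  pattern_link k x y -> pattern_link k' x y -> k = k'.
Proof. by case/and5P=> _ _ _ _ /eqP <- /and5P[_ _ _ _ /eqP]. Qed.

Definition pattern_graph : pgraph 'I_r (@ptype_rk s N) :=
  PGraph pattern_link_rk pattern_link_uniq.

(** A colouring that is constant on each type of links is a function g as in
    [mono_pattern]. *)
Lemma mono_pattern_copy (T : pgraph 'I_r (@ptype_rk s N)) (c : T -> T -> 'I_r)
    (f : pattern_graph -> T) :
  (forall g : ptype s N -> ptype s N -> 'I_r -> 'I_r, has_mono_pattern q' allowed g) ->
  (forall a b k, type_mono (T := pattern_graph) (fun x y => c (f x) (f y)) a b k) ->
  exists t k, valid allowed t /\
    forall h h', adj h h' -> kappa h < kappa h' -> c (f (t, h)) (f (t, h')) = k.
Proof.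
move=> mono fm.
have [t [k [vt tk]]] := mono (fun a b k =>
  if [pick z : pattern_graph * pattern_graph | typed_link a b k z] is Some z
  then c (f z.1) (f z.2) else ord0).
exists t, k; split=> // h h' hh' lt_hh'; rewrite -(tk _ _ lt_hh').
have th : typed_link (T := pattern_graph) (t.1 (kappa h)) (t.1 (kappa h'))
    (t.2 (kappa h, kappa h')) ((t, h), (t, h')).
  by rewrite /typed_link /= /pattern_link /= vt hh' lt_hh' !eqxx.
case: pickP => [[x y] xy|/(_ ((t, h), (t, h')))]; last by rewrite th.
exact: fm th xy.
Qed.

Lemma pattern_graph_hom (J : sgraph) (f : J -> underlying pattern_graph) :
  chromatically_connected3 J -> graph_hom f -> exists t, valid allowed t /\
  forall x, (f x).1 = t.
Proof.
move=> J3 fhom; have [le3J conJ] := J3.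
have [x0 _] : exists x0, x0 \in J by apply/card_gt0P; apply: leq_trans le3J.
have tE x y : adj x y -> valid allowed (f x).1 /\ (f x).1 = (f y).1.
  by move/fhom/existsP=> [k /orP[]] /and5P[/eqP e v _ _ _]; rewrite ?e //; split=> //;
    rewrite -e.
have [y0 xy0] := chromatically_connected3_neighbour x0 J3.
exists (f x0).1; split=> [|x]; first exact: (tE _ _ xy0).1.
have conT : connected (delete_vertices (set0 : {set J})).
  by apply/conJ/(@bipartite_induced _ _ predT) => u w; rewrite inE.
refine (@connected_delete_ind _ _ (fun x => (f x).1 = (f x0).1) conT _ x0 x _ _ _);
  rewrite ?inE //.
by move=> u w _ _ /tE[_ ->].
Qed.

End PatternGraph.

Section Blowup.
Variables (r' s q' : nat) (H : sgraph) (kappa : H -> 'I_q'.+3).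
Notation r := r'.+2.
Notation q := q'.+3.
Hypothesis kappaP : forall h h', adj h h' -> kappa h != kappa h'.
Hypothesis kappa_gt0 : 0 < #|[set h | kappa h == ord0]|.
Hypothesis kappa_min : forall kappa' : H -> 'I_q,
  (forall h h', adj h h' -> kappa' h != kappa' h') ->
  #|[set h | kappa h == ord0]| <= #|[set h | kappa' h == ord0]|.
Hypothesis H3 : chromatically_connected3 H.

(** A monochromatic H[2] lies over one pattern t. If some pair of classes of t
    never shows the colour k0, these two classes can be merged, and H would
    have a q-colouring with an empty first class. Otherwise a vertex of the first
    class over an index at which t is not monochromatic misses some class
    entirely and can be moved there. The new q-colouring of H[2] has in its first
    class only vertices over one index, which are determined by the vertex of H
    below them; the first classes of the two disjoint copies of H cannot both
    fit in. *)
Theorem arrows_blowup_separation : #|H| != 3 ->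
  exists G, arrows G r H /\ ~ arrows (blowup G s) r (blowup H 2).
Proof.
move=> card_H.
pose allowed (A A' : {set 'I_s}) (k : 'I_r) := true.
have [N HN] := @mono_pattern r' s q' allowed (fun _ _ _ _ => conj isT (fun=> isT)).
have [T [homT monoT]] := partite_construction (pattern_graph N allowed kappa) 'I_r.
exists (underlying T); split.
  move=> c; have [f [[fI fp fl] fm]] := monoT (fun x y => c [set x; y]).
  have [t [k [vt tk]]] :=
    mono_pattern_copy (c := fun x y : T => c [set x; y]) (f := f) HN fm.
  exists k, (fun h => f (t, h)); split=> [h h' /fI[]//|h h' hh'].
  have fadj h1 h2 : adj h1 h2 -> kappa h1 < kappa h2 ->
      link (t.2 (kappa h1, kappa h2)) (f (t, h1)) (f (t, h2)).
    by move=> h12 lt12; rewrite fl /= /pattern_link /= vt h12 lt12 !eqxx.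
  have := kappaP hh'; rewrite -(inj_eq val_inj) neq_ltn => /orP[]lt_h.
    split; last exact: tk.
    by apply/existsP; exists (t.2 (kappa h, kappa h')); rewrite fadj.
  rewrite adj_sym in hh'; split; last by rewrite setUC; apply: tk.
  by apply/existsP; exists (t.2 (kappa h', kappa h)); rewrite fadj ?orbT.
pose D (x y : T * 'I_s) : 'I_r :=
  if [pick k | link k x.1 y.1] is Some k
  then link_colour x.2 (part x.1) (part y.1) k else ord0.
have [c cD] := oriented_colouring (fun x : T * 'I_s => ptype_rk (part x.1)) D ord0.
move/(_ c)=> [k0 [f [fI fk0]]].
pose J := blowup H 2.
have J3 : chromatically_connected3 J := chromatically_connected3_blowup2 H3 card_H.
have fhom : graph_hom (fun x : J => (f x).1 : underlying T).
  by move=> x y /fk0[].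
have [g [f' [[gI gp gl] ff']]] := homT J _ J3 fhom.
have f'hom : graph_hom (f' : J -> underlying (pattern_graph N allowed kappa)).
  move=> x y /fhom/existsP[k]; rewrite !ff' /= !gl => kxy.
  by apply/existsP; exists k.
have [t [vt tE]] := pattern_graph_hom J3 f'hom.
have /validP[vt1 vt2] := vt.
pose cl (x : J) := kappa (f' x).2.
have f'E x : f' x = (t, (f' x).2) by rewrite -(tE x) -surjective_pairing.
have clP x y : adj x y -> cl x != cl y.
  move/f'hom/existsP=> [k /orP[]] /and5P[_ _ _ + _]; rewrite -/(cl x) -/(cl y);
    rewrite -(inj_eq val_inj) neq_ltn => ->; rewrite ?orbT //.
have colP x y : adj x y -> cl x < cl y ->
    link_colour (f x).2 (t.1 (cl x)) (t.1 (cl y)) (t.2 (cl x, cl y)) = k0.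
  move=> xy lt_xy; have [_ <-] := fk0 _ _ xy.
  have lxy : link (t.2 (cl x, cl y)) (f x).1 (f y).1.
    rewrite !ff' /= gl f'E [f' y]f'E /= /pattern_link /= vt lt_xy !eqxx /= andbT.
    move/f'hom/existsP: xy => [k /orP[]] /and5P[_ _ + _ _] //.
    by rewrite adj_sym.
  rewrite cD; last exact: link_rk lxy.
  rewrite /D; case: pickP => [k lk|/(_ (t.2 (cl x, cl y)))]; last by rewrite lxy.
  rewrite (link_uniq lk lxy) !ff' /= !gp /= /pattern_part.
  by rewrite !tE.
have local_index i i' c1 c2 : t.1 c1 != None ->
    link_colour i (t.1 c1) (t.1 c2) (t.2 (c1, c2)) =
    link_colour i' (t.1 c1) (t.1 c2) (t.2 (c1, c2)) by case: (t.1 c1).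
have [/existsP[c1 /existsP[c2 /andP[lt12 /forallP no12]]]|/existsPn some12] :=
    boolP [exists c1 : 'I_q, exists c2 : 'I_q, (c1 < c2) && [forall i,
      link_colour i (t.1 c1) (t.1 c2) (t.2 (c1, c2)) != k0]].
  (* The class c1 is merged into c2, and class 0 takes the place of c1. *)
  pose ncl x := if cl x == c1 then c2 else if cl x == ord0 then c1 else cl x.
  have c21 : c2 != c1 by rewrite -(inj_eq val_inj) gtn_eqF.
  have c20 : c2 != ord0 by rewrite -(inj_eq val_inj) -lt0n (leq_ltn_trans _ lt12).
  have sep x y : adj x y -> cl x = c1 -> cl y <> c2.
    move=> xy x1 y2; have := colP _ _ xy; rewrite x1 y2 => /(_ lt12).
    by apply/eqP/no12.
  have /kappa_min : forall h h', adj h h' ->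
      ncl ((h, ord0) : J) != ncl ((h', ord0) : J).
    move=> h h' hh'; have xy : adj ((h, ord0) : J) ((h', ord0) : J) by [].
    have yx : adj ((h', ord0) : J) ((h, ord0) : J) by rewrite adj_sym.
    move: (clP _ _ xy) (sep _ _ xy) (sep _ _ yx); rewrite /ncl.
    move: (cl ((h, ord0) : J)) (cl ((h', ord0) : J)) => u w uw s1 s2.
    have [eu|u1] := eqVneq u c1; have [ew|w1] := eqVneq w c1.
    - by rewrite eu ew eqxx in uw.
    - have [_|_] // := eqVneq w ord0.
      by rewrite eq_sym; apply/eqP; apply: s1.
    - have [_|_] := eqVneq u ord0; first by rewrite eq_sym.
      by apply/eqP; apply: s2.
    - have [eu|u0] := eqVneq u ord0; have [ew|w0] := eqVneq w ord0 => //.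
        by rewrite eu ew eqxx in uw.
      by rewrite eq_sym.
  rewrite leqNgt (leq_ltn_trans _ kappa_gt0) // leqn0 cards_eq0.
  apply/eqP/setP=> h; rewrite !inE /ncl.
  have [_|u1] := eqVneq (cl _) c1; first exact: negbTE.
  by have [u0|u0] := eqVneq (cl _) ord0; [rewrite -u0 eq_sym; apply: negbTE | apply: negbTE].
pose mono (x : J) := mono_at t k0 (f x).2.
pose bad (x : J) (c' : 'I_q) := (0 < c') &&
  (link_colour (f x).2 (t.1 ord0) (t.1 c') (t.2 (ord0, c')) != k0).
have badP x : ~~ mono x -> exists c', bad x c'.
  case/forallPn=> c1 /forallPn[c2]; rewrite negb_imply => /andP[lt12 nk].
  have c10 : c1 = ord0.
    have /existsPn/(_ c2)/nandP[/negP[]|/forallPn[i]] := some12 c1; first exact: lt12.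
    rewrite negbK => /eqP ki.
    have t1 : t.1 c1 = None.
      by apply/eqP/negPn/negP => t1; rewrite (local_index _ i) // ki eqxx in nk.
    apply/val_inj/eqP; rewrite -leqn0 leqNgt; apply/negP => c1_gt0.
    by have [] := vt1 ord0 c1 c1_gt0; rewrite t1.
  by exists c2; rewrite /bad (leq_ltn_trans _ lt12) // -c10 nk.
pose ncl x := if (cl x == ord0) && ~~ mono x then odflt ord0 [pick c' | bad x c'] else cl x.
have ncl_bad x : cl x = ord0 -> ~~ mono x -> bad x (ncl x).
  move=> x0 mx; rewrite /ncl x0 eqxx mx /=; case: pickP => //= none.
  by have [c'] := badP _ mx; rewrite none.
have ncl_half x y : adj x y -> cl x = ord0 -> ~~ mono x -> ncl x != ncl y.
  move=> xy x0 mx; have := ncl_bad _ x0 mx.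
  have := clP _ _ xy; rewrite x0 => y0.
  have -> : ncl y = cl y by rewrite /ncl eq_sym (negPf y0).
  case/andP=> c_gt0 ck; apply/eqP=> exy; move: ck.
  by rewrite -x0 exy colP ?eqxx // x0 -exy.
have nclP x y : adj x y -> ncl x != ncl y.
  move=> xy; have [/andP[/eqP x0 mx]|hx] := boolP ((cl x == ord0) && ~~ mono x).
    exact: ncl_half.
  have [/andP[/eqP y0 my]|hy] := boolP ((cl y == ord0) && ~~ mono y).
    by rewrite eq_sym; apply: ncl_half => //; rewrite adj_sym.
  by rewrite /ncl (negPf hx) (negPf hy) clP.
have ncl0 x : ncl x = ord0 -> cl x = ord0 /\ mono x.
  move=> x0; have [/andP[/eqP cx mx]|hx] := boolP ((cl x == ord0) && ~~ mono x).
    by have := ncl_bad _ cx mx; rewrite x0.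
  have cx : cl x = ord0 by move: x0; rewrite /ncl (negPf hx).
  by split=> //; rewrite cx eqxx negbK in hx.
have ncl_inj x y : ncl x = ord0 -> ncl y = ord0 -> (f' x).2 = (f' y).2 -> x = y.
  move=> /ncl0[_ mx] /ncl0[_ my] exy; apply: fI.
  have := vt2 _ _ _ mx my; have : (f x).1 = (f y).1 by rewrite !ff' /= f'E [f' y]f'E exy.
  by case: (f x) (f y) => [u i] [w j] /= -> ->.
(* By minimality the new first class of either copy of H already fills the
   first class of the pattern. *)
pose zero (b : 'I_2) := [set (f' ((h, b) : J)).2 | h in [set h | ncl ((h, b) : J) == ord0]].
have zeroE b : zero b = [set h | kappa h == ord0].
  apply/eqP; rewrite eqEcard; apply/andP; split.
    apply/subsetP=> _ /imsetP[h + ->]; rewrite !inE => /eqP/ncl0[<- _].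
    by rewrite eqxx.
  rewrite card_in_imset; first by apply: kappa_min => h h' hh'; apply: nclP.
  by move=> h h'; rewrite !inE => /eqP h0 /eqP h'0 /(ncl_inj _ _ h0 h'0)[].
have /card_gt0P[h0 h0S] := kappa_gt0.
have: h0 \in zero ord0 by rewrite zeroE.
case/imsetP=> h; rewrite inE => /eqP hz eh.
have: h0 \in zero ord_max by rewrite zeroE.
case/imsetP=> h'; rewrite inE => /eqP hz' eh'.
by have [] := ncl_inj _ _ hz hz' (etrans (esym eh) eh').
Qed.
End Blowup.

(** * The triangle *)

Section Merge.
Variables (r' s N : nat) (T : pgraph 'I_r'.+2 (@ptype_rk s N)).
Notation r := r'.+2.

Definition has_set (p : ptype s N) := if p is Some (_, Some _) then true else false.

(** All vertices of type [None] become the single vertex [None]. The links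
    allowed between types carrying sets are imposed again, because
    only the images of 3-chromatically connected graphs in T are known to come
    from patterns, and a single edge is not such a graph. *)
Definition merge_adj : rel (option T) := fun u w =>
  match u, w with
  | None, None => false
  | None, Some x | Some x, None => has_set (part x)
  | Some x, Some y => [&& part x != None, part y != None &
      [exists k, (link k x y && link_ok (@few r' s) (part x) (part y) k) ||
                 (link k y x && link_ok (@few r' s) (part y) (part x) k)]]
  end.

Lemma merge_adj_sym : symmetric merge_adj.
Proof.
move=> [x|] [y|] //=; rewrite andbCA; congr [&& _, _ & _].
by apply: eq_existsb => k; rewrite orbC.
Qed.

Lemma merge_adj_irr : irreflexive merge_adj.
Proof.
move=> [x|] //=; apply/and3P=> -[_ _ /existsP[k]].
by rewrite orbb => /andP[/link_rk]; rewrite ltnn.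
Qed.

Definition merged : sgraph := SGraph merge_adj_sym merge_adj_irr.

Definition merge (x : T) : merged := if part x == None then None else Some x.
End Merge.

Section Triangle.
Variables (r' s : nat) (H : sgraph).
Notation r := r'.+2.
Hypothesis H3 : chromatically_connected3 H.
Hypothesis card_H : #|H| = 3.
Hypothesis hs : 1 < s.

(** A triangle of K_3[2] avoiding the merged vertex v would lie over a pattern
    that avoids [None] and be monochromatic over every index. So some part of
    the octahedron consists of two copies of v, whose indices are both coloured
    k0 by the two sets A and A' carried by any opposite edge. But that edge
    satisfies [few A A' k0]. *)
Theorem arrows_blowup_separation_triangle :
  exists G, arrows G r H /\ ~ arrows (blowup G s) r (blowup H 2).
Proof.
have adjH (x y : H) : x != y -> adj x y by apply: card3_complete.
pose kappa (h : H) : 'I_3 := cast_ord card_H (enum_rank h).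
have kappaI : injective kappa by move=> x y /cast_ord_inj/enum_rank_inj.
have kappaP (h h' : H) : adj h h' -> kappa h != kappa h'.
  by apply: contraTneq => /kappaI->; rewrite adj_irr.
have allowedP A A' k : few A A' k -> few A A' k /\ (0 < 0 -> @few r' s A' A' k).
  by [].
have [N HN] := @mono_pattern r' s 0 (@few r' s) allowedP.
have [T [homT monoT]] := partite_construction (pattern_graph N (@few r' s) kappa) 'I_r.
exists (merged T); split.
  move=> c; have [f [[fI fp fl] fm]] := monoT (fun x y => c [set merge x; merge y]).
  have [t [k [vt tk]]] := mono_pattern_copy
    (c := fun x y : T => c [set merge x; merge y]) (f := f) HN fm.
  have /validP[vt1 _] := vt.
  have partE h : part (f (t, h)) = t.1 (kappa h) by rewrite fp.
  have madj h h' : adj h h' -> kappa h < kappa h' ->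
      adj (merge (f (t, h))) (merge (f (t, h'))).
    move=> hh' lt_hh'; have [rk_hh' ok] := vt1 _ _ lt_hh'.
    have lk : link (t.2 (kappa h, kappa h')) (f (t, h)) (f (t, h')).
      by rewrite fl /= /pattern_link /= vt hh' lt_hh' !eqxx.
    have p' : (part (f (t, h')) == None) = false.
      by apply/negbTE/eqP; rewrite partE => p'; rewrite p' in rk_hh'.
    rewrite /merge p'; case: eqP => [p|/eqP p] /=.
      by rewrite partE; rewrite partE in p; move: ok; rewrite p; case: (t.1 _) => [[? []]|].
    by rewrite p p' /=; apply/existsP; exists (t.2 (kappa h, kappa h'));
      rewrite lk !partE ok.
  exists k, (fun h => merge (f (t, h))); split.
    move=> h h' eh; apply/eqP/negPn/negP => hh'.
    have := kappaP _ _ (adjH _ _ hh'); rewrite -(inj_eq val_inj) neq_ltn => /orP[]lt_h.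
      by have := madj _ _ (adjH _ _ hh') lt_h; rewrite eh adj_irr.
    rewrite eq_sym in hh'.
    by have := madj _ _ (adjH _ _ hh') lt_h; rewrite eh adj_irr.
  move=> h h' hh'.
  have := kappaP _ _ hh'; rewrite -(inj_eq val_inj) neq_ltn => /orP[]lt_h.
    by split; [apply: madj | apply: tk].
  rewrite adj_sym in hh'; rewrite setUC adj_sym.
  by split; [apply: madj | apply: tk].
pose D (x y : merged T * 'I_s) : 'I_r :=
  match x.1, y.1 with
  | None, Some w => if part w is Some (_, Some A) then tint r' A x.2 else ord0
  | Some u, Some w => odflt ord0 [pick k | link k u w]
  | _, _ => ord0
  end.
have [c cD] := oriented_colouring
  (fun x : merged T * 'I_s => if x.1 is Some u then (ptype_rk (part u)).+1 else 0) D ord0.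
move/(_ c)=> [k0 [f [fI fk0]]].
have cL (u w : T) i j k : link k u w -> c [set (Some u, i); (Some w, j)] = k.
  move=> lk; rewrite cD /=; last by rewrite ltnS; apply: link_rk lk.
  rewrite /D /=; case: pickP => [k' lk'|/(_ k)]; last by rewrite lk.
  exact: link_uniq lk' lk.
have cV (w : T) a A i j : part w = Some (a, Some A) ->
    c [set (None, i); (Some w, j)] = tint r' A i.
  by move=> pw; rewrite cD // /D /= pw.
have fadj (h h' : H) (b b' : 'I_2) : h != h' ->
    merge_adj (f (h, b)).1 (f (h', b')).1 /\ c [set f (h, b); f (h', b')] = k0.
  by move=> hh'; apply: fk0; apply: adjH.
have hit (b : H -> 'I_2) : exists h, (f (h, b h)).1 = None.
  have [/existsP[h /eqP]|/existsPn noNone] :=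
    boolP [exists h, (f (h, b h)).1 == None]; first by exists h.
  have /fin_all_exists[F FE] : forall h, exists x, (f (h, b h)).1 = Some x.
    by move=> h; have := noNone h; case: (f _).1 => [x|]; rewrite ?eqxx //; exists x.
  have Fadj (h h' : H) : h != h' ->
      [/\ part (F h) != None, part (F h') != None &
      exists k, link k (F h) (F h') || link k (F h') (F h)].
    move=> hh'; have [] := fadj h h' (b h) (b h') hh'; rewrite !FE /=.
    case/and3P=> p p' /existsP[k kE] _; split=> //; exists k.
    by case/orP: kE => /andP[-> _] //; rewrite orbT.
  have Fhom : graph_hom (F : H -> underlying T).
    move=> h h' hh'; have [|_ _ [k kE]] := Fadj h h'.
      by apply: contraTneq hh' => ->; rewrite adj_irr.
    by apply/existsP; exists k.
  have [g [F' [[gI gp gl] FF']]] := homT H _ H3 Fhom.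
  have F'hom : graph_hom (F' : H -> underlying (pattern_graph N (@few r' s) kappa)).
    move=> x y /Fhom/existsP[k]; rewrite !FF' /= !gl => kxy.
    by apply/existsP; exists k.
  have [t [vt tE]] := pattern_graph_hom H3 F'hom.
  have /validP[_ vt2] := vt.
  have F'E x : F' x = (t, (F' x).2) by rewrite -(tE x) -surjective_pairing.
  pose cl h := kappa (F' h).2.
  have clI : injective cl.
    move=> h h' /kappaI e; apply/eqP/negPn/negP => /adjH/F'hom.
    by rewrite F'E [F' h']F'E e adj_irr.
  have mono i : mono_at t k0 i.
    apply/mono_atP => c1 c2 lt12.
    have onto d : exists h, cl h = d.
      have /(inj_card_onto clI)/(_ d)/codomP[h ->] : #|'I_3| <= #|H| by rewrite card_H card_ord.
      by exists h.
    have [[h1 e1] [h2 e2]] := (onto c1, onto c2).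
    have h12 : h1 != h2 by apply: contraTneq lt12 => e; rewrite -e1 -e2 e ltnn.
    have [p1 _ _] := Fadj _ _ h12.
    have lk : link (t.2 (c1, c2)) (F h1) (F h2).
      rewrite !FF' /= gl F'E [F' h2]F'E; apply/and5P; split=> //.
      - by apply: adjH; apply: contraTneq lt12 => /= e; rewrite -e1 -e2 /cl e ltnn.
      - by rewrite -[kappa _]/(cl h1) -[X in _ < X]/(val (cl h2)) e1 e2.
      - by rewrite -[kappa _]/(cl h1) -[X in t.2 (_, X)]/(cl h2) e1 e2.
    have [_] := fadj h1 h2 (b h1) (b h2) h12.
    move: (FE h1) (FE h2); case: (f _) => [_ i1] /= ->; case: (f _) => [_ i2] /= ->.
    rewrite (cL _ _ _ _ _ lk) => <-.
    move: p1; rewrite FF' /= gp /= /pattern_part F'E /= -/(cl h1) e1.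
    by rewrite /link_colour; case: (t.1 c1).
  by have := vt2 _ _ _ (mono (Ordinal (ltnW hs))) (mono (Ordinal hs)) => /(congr1 val).
have [h hN] : exists h, forall b, (f (h, b)).1 = None.
  have [h] := hit (fun h => if (f (h, ord0)).1 == None then ord_max else ord0).
  case: eqP => [h0 h1|//]; exists h => -[[|[|b]] lt_b] //.
    by rewrite -h0; congr (f (_, _)).1; apply: val_inj.
  by rewrite -h1; congr (f (_, _)).1; apply: val_inj.
have /cards2P[x [y [xy xyE]]] : #|~: [set h]| == 2.
  by rewrite cardsCs setCK card_H cards1.
have xh : x != h by rewrite -in_set1 -in_setC xyE set21.
have yh : y != h by rewrite -in_set1 -in_setC xyE set22.
have spoke z : z != h -> exists w a A, [/\ (f (z, ord0)).1 = Some w,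
    part w = Some (a, Some A) & forall b, tint r' A (f (h, b)).2 = k0].
  move=> zh; have hz : h != z by rewrite eq_sym.
  have [] := fadj h z ord0 ord0 hz; rewrite hN /=.
  case fz : (f (z, ord0)) => [[w|] j] //=.
  case pw : (part w) => [[a [A|]]|] //= _ _; exists w, a, A; split=> // b.
  have [_] := fadj h z b ord0 hz; rewrite fz; move: (hN b).
  by case: (f (h, b)) => [_ i] /= ->; rewrite (cV _ _ _ _ _ pw).
have [u [a [A [fx pu uk]]]] := spoke x xh.
have [w [a' [A' [fy pw wk]]]] := spoke y yh.
have [] := fadj x y ord0 ord0 xy; rewrite fx fy /= pu pw /= => /existsP[k kE] ck.
have {kE} fewA : few A A' k0 \/ few A' A k0.
  move: fx fy ck; case: (f (x, _)) => [_ i] /= ->; case: (f (y, _)) => [_ j] /= ->.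
  case/orP: kE => /andP[lk fewA]; [|rewrite setUC]; rewrite (cL _ _ _ _ _ lk) => <-.
    by left.
  by right.
have idx : (f (h, ord0)).2 = (f (h, ord_max)).2.
  have inA B B' b : (forall b, tint r' B (f (h, b)).2 = k0) ->
      (forall b, tint r' B' (f (h, b)).2 = k0) ->
      (f (h, b)).2 \in [set i | (tint r' B i == k0) && (tint r' B' i == k0)].
    by move=> Bk B'k; rewrite inE Bk B'k eqxx.
  by case: fewA => /card_le1_eqP; apply; apply: inA.
have /fI[] // : f (h, ord0) = f (h, ord_max).
by rewrite [LHS]surjective_pairing [RHS]surjective_pairing !hN idx.
Qed.
End Triangle.

(** * Colourings with a smallest first class *)

(** The number of classes is minimal first, so that no class can be empty, and
    then the size of the first class. *)
Lemma minimal_colouring (H : sgraph) : chromatically_connected3 H ->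
  exists q' (kappa : H -> 'I_q'.+3),
    [/\ forall h h', adj h h' -> kappa h != kappa h',
        0 < #|[set h | kappa h == ord0]| &
        forall kappa' : H -> 'I_q'.+3,
          (forall h h', adj h h' -> kappa' h != kappa' h') ->
          #|[set h | kappa h == ord0]| <= #|[set h | kappa' h == ord0]|].
Proof.
move=> H3.
pose proper q (k : {ffun H -> 'I_q}) := [forall h, forall h', adj h h' ==> (k h != k h')].
have properP q (k : {ffun H -> 'I_q}) :
    reflect (forall h h', adj h h' -> k h != k h') (proper q k).
  apply: (iffP forallP) => [P h h' hh'|P h].
    by have /forallP/(_ h') := P h; rewrite hh'.
  by apply/forallP=> h'; apply/implyP; apply: P.
have ex : exists q, [exists k, proper q k].
  exists #|H|; apply/existsP; exists [ffun h => enum_rank h]; apply/properP => h h' hh'.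
  by rewrite !ffunE; apply: contraTneq hh' => /enum_rank_inj->; rewrite adj_irr.
have [q /existsP[k0 k0P] q_min] := ex_minnP ex.
have q_ge3 : 2 < q.
  rewrite ltnNge; apply/negP => q2; apply: (chromatically_connected3_not_bipartite H3).
  exists (fun h => k0 h == 0 :> nat) => x y /(properP _ _ k0P).
  rewrite -(inj_eq val_inj) /=; case: (k0 x) (k0 y) => [i iq] [j jq] /=.
  by move: (leq_trans iq q2) (leq_trans jq q2); case: i {iq} => [|[]]; case: j {jq} => [|[]].
case: q q_ge3 k0 k0P q_min => [|[|[|q']]] // _ k0 k0P q_min.
case: (@arg_minnP _ k0 (proper _) (fun k : {ffun H -> 'I_q'.+3} => #|[set h | k h == ord0]|) k0P).
move=> k kP k_min; exists q', k; split; first exact/properP.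
  rewrite lt0n cards_eq0; apply/negP => /eqP k0E.
  have k_gt0 h : 0 < k h.
    by have := in_set0 h; rewrite -k0E inE lt0n => /negbT.
  have k_lt h : (k h).-1 < q'.+2 by rewrite prednK // -ltnS ltn_ord.
  suff /q_min : [exists k, proper q'.+2 k] by rewrite ltnn.
  apply/existsP; exists [ffun h => Ordinal (k_lt h)]; apply/properP=> h h' hh'.
  rewrite !ffunE; move/properP/(_ _ _ hh'): kP; apply: contraNneq => -[e].
  by apply/eqP/val_inj; rewrite /= -(prednK (k_gt0 h)) -(prednK (k_gt0 h')) e.
move=> k' k'P; have := k_min [ffun h => k' h].
have -> : [set h | [ffun h => k' h] h == ord0] = [set h | k' h == ord0].
  by apply/setP=> h; rewrite !inE ffunE.
by apply; apply/properP=> h h' hh'; rewrite !ffunE k'P.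
Qed.

Theorem theorem1p5 (H : sgraph) (r s : nat)
    (hH : chromatically_connected3 H) (hr : 2 <= r) (hs : 2 <= s) :
  exists G : sgraph,
    arrows G r H /\ ~ arrows (blowup G s) r (blowup H 2).
Proof.
case: r hr => [|[|r']] // _.
have [card_H|card_H] := eqVneq #|H| 3; first exact: arrows_blowup_separation_triangle.
have [q' [kappa [kappaP kappa_gt0 kappa_min]]] := minimal_colouring hH.
exact: arrows_blowup_separation kappaP kappa_gt0 kappa_min hH card_H.
Qed.
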